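(* Let $n\ge 2$ be an integer, let $\tau=\lceil \log_2(n)\rceil$, and let $\{W^{(l)}\}_{l\in\mathbb N}\subset\mathbb R^{n\times n}$ be the weight matrices of the one-peer exponential graphs, i.e. $W^{(l)}=[w^{(l)}_{ij}]_{i,j=0}^{n-1}$ with $$w^{(l)}_{ij}=\begin{cases}\frac12 & \text{if } \mathrm{mod}(j-i,n)=2^{\mathrm{mod}(l,\tau)},\\ \frac12 & \text{if } i=j,\\ 0&\text{otherwise.}\end{cases}$$ Then each matrix $W^{(l)}$ is circulant and doubly stochastic, i.e. $W^{(l)}\mathbf 1=\mathbf 1$ and $\mathbf 1^{\mathsf T}W^{(l)}=\mathbf 1^{\mathsf T}$. In addition, if $n$ is a power of 2 (i.e. $n=2^\tau$) and the index sequence $\{l_i\}_{i=0}^{\tau-1}\subset\mathbb N$ satisfies $\{\mathrm{mod}(l_0,\tau),\dots,\mathrm{mod}(l_{\tau-1},\tau)\}=\{0,\dots,\tau-1\}$, then the matrices $\{W^{(l_i)}\}_{i=0}^{\tau-1}$ have the finite-time consensus property with parameter $\tau$.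
   Context: $\mathbb N=\{0,1,2,\dots\}$; $\mathrm{mod}(a,m)\in\{0,\dots,m-1\}$ is the remainder of the integer $a$ modulo $m$; $\mathbf 1\in\mathbb R^n$ is the all-ones vector; rows and columns of $n\times n$ matrices are indexed by $0,1,\dots,n-1$. A matrix is circulant if its $(i,j)$ entry depends only on $\mathrm{mod}(i-j,n)$. Finite-time consensus property: a finite sequence of matrices $\{A^{(i)}\}_{i=0}^{\tau-1}\subset\mathbb R^{n\times n}$ (weight matrices of graphs on $n$ nodes), $\tau\ge 1$, has the finite-time consensus property with parameter $\tau$ if and only if every $A^{(i)}$ is doubly stochastic and $A^{(\tau-1)}A^{(\tau-2)}\cdots A^{(1)}A^{(0)}=\frac1n\mathbf 1\mathbf 1^{\mathsf T}$. *)

(* Defs.v *)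
From mathcomp Require Import all_boot all_order all_algebra.
From mathcomp Require Import reals.

Set Implicit Arguments.
Unset Strict Implicit.
Unset Printing Implicit Defensive.

Import Order.TTheory GRing.Theory Num.Theory.

Local Open Scope ring_scope.

(* [up_log 2 n] is the least e with n <= 2 ^ e, that is, the ceiling of the
   base-2 logarithm of n for n >= 1. *)
Definition ceil_log2 (n : nat) : nat := up_log 2 n.

Definition ones (R : realType) (n : nat) : 'cV[R]_n := const_mx 1.

(* The differences are taken in [int], since subtraction on [nat] truncates. *)
Definition circulant (R : realType) (n : nat) (A : 'M[R]_n) : Prop :=
  forall i j i' j' : 'I_n,
    ((i%:Z - j%:Z) %% n%:Z)%Z = ((i'%:Z - j'%:Z) %% n%:Z)%Z ->
    A i j = A i' j'.

(* Following the source, only the row and column sums are constrained, not the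
   signs of the entries. *)
Definition doubly_stochastic (R : realType) (n : nat) (A : 'M[R]_n) : Prop :=
  A *m ones R n = ones R n /\ (ones R n)^T *m A = (ones R n)^T.

(* [rev_ord] makes the factors appear as A (tau - 1), ..., A 1, A 0 from left
   to right. *)
Definition finite_time_consensus (R : realType) (n tau : nat)
    (A : 'I_tau -> 'M[R]_n) : Prop :=
  [/\ (1 <= tau)%N,
      forall i : 'I_tau, doubly_stochastic (A i) &
      \big[mulmx/1%:M]_(i < tau) A (rev_ord i)
        = n%:R^-1 *: (ones R n *m (ones R n)^T)].

Definition one_peer_exp (R : realType) (n l : nat) : 'M[R]_n :=
  \matrix_(i < n, j < n)
    if ((j%:Z - i%:Z) %% n%:Z)%Z == (2 ^ (l %% ceil_log2 n))%N%:Z then 2^-1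
    else if i == j then 2^-1
    else 0.

(* Main.v *)
(** Writing [S] for the cyclic shift matrix, the weight matrix with offset
    [2 ^ k] is [(1 + S ^ (2 ^ k)) / 2].  All factors are polynomials in [S],
    hence commute, and the product of the [1 + X ^ (2 ^ k)] for [k < t] is
    [1 + X + ... + X ^ (2 ^ t - 1)].  When [n = 2 ^ t], the sum of the first
    [n] powers of [S] is the all-ones matrix. *)
Require Import Defs.
From mathcomp Require Import all_boot all_order all_algebra.
From mathcomp Require Import reals.

Import Order.TTheory GRing.Theory Num.Theory.

Local Open Scope ring_scope.

(** Induction on [t]: in the new factor, the term [x ^+ (2 ^ t)] shifts the exponents below [2 ^ t]
    onto the next [2 ^ t] ones. *)
Lemma prod_1DX2_expr (A : comNzRingType) (x : A) (t : nat) :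
  \prod_(k < t) (1 + x ^+ (2 ^ k)) = \sum_(i < 2 ^ t) x ^+ i.
Proof.
elim: t => [|t IHt]; first by rewrite big_ord0 expn0 big_ord1 expr0.
rewrite big_ord_recr /= IHt expnS mul2n -addnn big_split_ord /=.
rewrite mulrDr mulr1; congr (_ + _).
by rewrite mulr_suml; apply: eq_bigr => i _; rewrite -exprD addnC.
Qed.

(** Passes from the integer residues of [one_peer_exp] to addition in ['I_m.+1], where shifts are
    expressed; the bound makes [d] its own residue. *)
Lemma eqz_modB_ord (m : nat) (i j : 'I_m.+1) (d : nat) : (d < m.+1)%N ->
  (((j%:Z - i%:Z) %% m.+1%:Z)%Z == d%:Z) = (j == i + inZp d :> 'I_m.+1).
Proof.
move=> ltdm; rewrite -val_eqE /= (modn_small ltdm).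
have -> : d%:Z = (d%:Z %% m.+1%:Z)%Z by rewrite modz_nat modn_small.
rewrite -(eqz_modDr i%:Z) subrK -PoszD addnC !modz_nat.
by rewrite eqz_nat (modn_small (ltn_ord j)).
Qed.

Lemma ord_subr_eq0 (n : nat) (i j : 'I_n) :
  (((j%:Z - i%:Z) %% n%:Z)%Z == 0) = (i == j).
Proof.
case: n i j => [|m] i j; first by case: i.
rewrite (eqz_modB_ord _ _ _ 0) // eq_sym; congr (_ == _).
by apply: val_inj; rewrite /= mod0n addn0 modn_small.
Qed.

Section CyclicShift.
Variables (R : realType) (m : nat).

Definition cyclic_shift : 'M[R]_m.+1 :=
  \matrix_(i, j) (j == i + inZp 1)%:R.

Lemma cyclic_shiftX (k : nat) (i j : 'I_m.+1) :
  (cyclic_shift ^+ k) i j = (j == i + inZp k)%:R.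
Proof.
elim: k i j => [|k IHk] i j.
  rewrite expr0 mxE eq_sym; congr (_ == _)%:R.
  by apply: val_inj; rewrite /= mod0n addn0 modn_small.
rewrite exprS -mulmxE mxE (bigD1 (i + inZp 1)) //= big1 => [|l /negPf neq].
  rewrite mxE eqxx mul1r addr0 IHk; congr (_ == _)%:R.
  rewrite -addrA; congr (_ + _).
  by apply: val_inj; rewrite /= modnDm.
by rewrite mxE neq mul0r.
Qed.

Lemma cyclic_shiftX_doubly_stochastic (k : nat) :
  doubly_stochastic (cyclic_shift ^+ k).
Proof.
split; apply/matrixP=> i j; rewrite !mxE.
  rewrite (bigD1 (i + inZp k)) //= big1 => [|l /negPf neq].
    by rewrite cyclic_shiftX eqxx mxE mulr1 addr0.
  by rewrite cyclic_shiftX neq mul0r.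
rewrite (bigD1 (j - inZp k)) //= big1 => [|l neq].
  by rewrite cyclic_shiftX subrK eqxx !mxE mulr1 addr0.
by rewrite cyclic_shiftX -subr_eq eq_sym (negPf neq) mulr0.
Qed.

(** Exactly one of these powers has a 1 at position [(i, j)]: the one with exponent [j - i], taken
    in ['I_m.+1]. *)
Lemma sum_cyclic_shiftX :
  \sum_(k < m.+1) cyclic_shift ^+ k = ones R m.+1 *m (ones R m.+1)^T.
Proof.
apply/matrixP=> i j; rewrite summxE !mxE big_ord1 !mxE mulr1.
rewrite (bigD1 (j - i)) // big1 => [|k /andP[_ neq]].
  by rewrite cyclic_shiftX valZpK [i + _]addrC subrK eqxx /= addr0.
by rewrite cyclic_shiftX valZpK [i + _]addrC -subr_eq eq_sym (negPf neq).
Qed.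

End CyclicShift.

(** By minimality of [up_log], an exponent below it gives a power of 2 less than [n]. Each offset is
    thus its own residue modulo [n]. *)
Lemma exp_modn_ceil_log2_lt (n l : nat) : (2 <= n)%N ->
  (2 ^ (l %% ceil_log2 n) < n)%N.
Proof.
move=> n_gt1; have t_gt0 : (0 < ceil_log2 n)%N by rewrite up_log_gt0.
rewrite ltnNge; apply/negP => /(up_log_min (isT : 1 < 2)%N).
by rewrite leqNgt ltn_pmod.
Qed.

Lemma one_peer_expE (R : realType) (m l : nat) : (2 <= m.+1)%N ->
  one_peer_exp R m.+1 l
    = 2^-1 *: (1 + cyclic_shift R m ^+ (2 ^ (l %% ceil_log2 m.+1))).
Proof.
move=> n_gt1; apply/matrixP => i j.
have lt2n := @exp_modn_ceil_log2_lt _ l n_gt1.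
rewrite !mxE cyclic_shiftX -(eqz_modB_ord _ _ _ _ lt2n).
case: eqP => [eqd|_]; last first.
  by case: eqP; rewrite ?mulr1n ?mulr0n addr0 ?mulr1 ?mulr0.
(* The residue is a power of 2, hence nonzero, so [i != j]: the two halves never fall on the same
   entry. *)
rewrite -ord_subr_eq0 eqd eqz_nat expn_eq0 /=.
by rewrite add0r mulr1.
Qed.

Lemma one_peer_exp_circulant (R : realType) (n l : nat) :
  circulant (one_peer_exp R n l).
Proof.
move=> i j i' j' eq_ij; rewrite !mxE -!ord_subr_eq0.
suff -> : ((j%:Z - i%:Z) %% n%:Z)%Z = ((j'%:Z - i'%:Z) %% n%:Z)%Z by [].
(* [circulant] compares [i - j] while the weights depend on [j - i]; negation modulo [n] relates
   them. *)
by rewrite -opprB -modzNm eq_ij modzNm opprB.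
Qed.

Lemma one_peer_exp_doubly_stochastic (R : realType) (n l : nat) :
  (2 <= n)%N -> doubly_stochastic (one_peer_exp R n l).
Proof.
case: n => // m n_gt1; rewrite one_peer_expE //.
have [Sr Sc] := cyclic_shiftX_doubly_stochastic R m (2 ^ (l %% ceil_log2 m.+1)).
have half2 (p q : nat) (A : 'M[R]_(p, q)) : 2^-1 *: (A + A) = A.
  by rewrite -mulr2n -scaler_nat scalerA mulVf ?scale1r ?pnatr_eq0.
split; first by rewrite -scalemxAl mulmxDl mul1mx Sr half2.
by rewrite -scalemxAr mulmxDr mulmx1 Sc half2.
Qed.

Lemma prod_one_peer_exp (R : realType) (n t : nat) (l : 'I_t -> nat) :
  (2 <= n)%N -> n = (2 ^ t)%N ->
  perm_eq [seq (l i %% ceil_log2 n)%N | i : 'I_t] (iota 0 t) ->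
  \big[mulmx/1%:M]_(i < t) one_peer_exp R n (l (rev_ord i))
    = n%:R^-1 *: (ones R n *m (ones R n)^T).
Proof.
case: n => // m n_gt1 def_n perm_l.
pose S := cyclic_shift R m; pose W (k : nat) : {poly R} := 1 + 'X ^+ (2 ^ k).
(* Each factor is the image of a polynomial under the ring morphism [horner_mx S], so the product
   can be reordered in the commutative ring [{poly R}]. *)
transitivity (\prod_(i < t)
    (2^-1 *: horner_mx S (W (l (rev_ord i) %% ceil_log2 m.+1)%N))).
  apply: eq_bigr => i _.
  by rewrite one_peer_expE // rmorphD rmorph1 rmorphXn /= horner_mx_X.
rewrite scaler_prod -rmorph_prod /= prodr_const card_ord.
(* The [t] scalars [2^-1] multiply to the inverse of [2 ^ t = n]. *)
rewrite exprVn -natrX -def_n; congr (_ *: _).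
rewrite (reindex_inj rev_ord_inj) /=.
under eq_bigr do rewrite rev_ordK.
have -> : \prod_(i < t) W (l i %% ceil_log2 m.+1)%N
          = \prod_(k <- iota 0 t) W k.
  by rewrite -(perm_big _ perm_l) /= big_image.
(* [index_iota 0 t] unfolds to [iota 0 (t - 0)], hence the inserted subtraction. *)
rewrite -[t in iota 0 t]subn0 -/(index_iota 0 t) big_mkord.
rewrite prod_1DX2_expr -def_n rmorph_sum -sum_cyclic_shiftX.
by apply: eq_bigr => k _; rewrite rmorphXn /= horner_mx_X.
Qed.

Theorem proposition3p1 (R : realType) (n : nat) (hn : (2 <= n)%N) :
  (forall l : nat,
     circulant (one_peer_exp R n l) /\ doubly_stochastic (one_peer_exp R n l))
  /\
  (n = (2 ^ ceil_log2 n)%N ->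
   forall l : 'I_(ceil_log2 n) -> nat,
     [seq (l i %% ceil_log2 n)%N | i : 'I_(ceil_log2 n)]
       =i iota 0 (ceil_log2 n) ->
     finite_time_consensus (fun i => one_peer_exp R n (l i))).
Proof.
split=> [l|def_n l eq_l].
  by split; [apply: one_peer_exp_circulant
            |apply: one_peer_exp_doubly_stochastic].
split=> [|i|]; first by rewrite up_log_gt0.
  exact: one_peer_exp_doubly_stochastic.
apply: prod_one_peer_exp => //.
(* A list of [t] numbers covering the [t] elements of [iota 0 t] repeats none. *)
have uniq_l : uniq [seq (l i %% ceil_log2 n)%N | i : 'I_(ceil_log2 n)].
  rewrite -(eq_uniq _ (fun x => esym (eq_l x))) ?iota_uniq //.
  by rewrite size_iota size_image card_ord.
exact: uniq_perm uniq_l (iota_uniq _ _) eq_l.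
Qed.
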